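(* The number of points in $\mathbb{R}_{1}^n$ with pairwise odd integral distances does not exceed $n!\cdot n\cdot \ln n \cdot (4+o(1))$ as $n \to \infty$. That is, for every $\varepsilon>0$ there exists $n_0$ such that for all $n\ge n_0$, every set $S\subset\mathbb{R}^n_1$ in which the distance between any two distinct points is an odd integer satisfies $|S|\le (4+\varepsilon)\, n!\, n\ln n$.
   Context: $\mathbb{R}^n_{1}$ denotes $\mathbb{R}^n$ equipped with the Manhattan metric $\|\mathbf{x}-\mathbf{y}\|_{1} = \sum_{i=1}^n |x_i-y_i|$. *)

(* Defs.v *)
From HB Require Import structures.
From mathcomp Require Export all_boot all_order all_algebra finmap.
From mathcomp Require Export all_classical all_reals exp.

Set Implicit Arguments.
Unset Strict Implicit.
Unset Printing Implicit Defensive.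

Import Order.TTheory GRing.Theory Num.Theory.
Local Open Scope classical_set_scope.
Local Open Scope ring_scope.

(* The norm that the library puts on row vectors is the sup norm, hence a
   separate definition. *)
Definition manhattan (R : realType) (n : nat) (x y : 'rV[R]_n) : R :=
  \sum_(i < n) `|x ord0 i - y ord0 i|.

Definition odd_integer (R : realType) (r : R) : Prop :=
  exists k : int, r = (2 * k + 1)%:~R.

Definition odd_distance_set (R : realType) (n : nat) (S : set 'rV[R]_n) : Prop :=
  forall x y : 'rV[R]_n, S x -> S y -> x <> y -> odd_integer (manhattan x y).

(* Main.v *)
(* Let D be the lattice of integer vectors with even coordinate sum.  If the
   distance of x and y is odd and d lies in D, then, with e_i the sign of
   x_i - y_i, the number sum_i e_i (x_i - y_i - d_i) is an odd integer minus an
   even one, so x and y + d are at distance at least 1.  Hence the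
   cross-polytopes of radius 1/2 centred at S + D are disjoint; each has volume
   1/n! and D has covolume 2, so |S| <= 2 n!.

   To avoid integration, volumes are replaced by counts of integer points after
   scaling by N and rounding down.  The rounding costs n in each distance, and
   with N of order n^2 it weakens the bound only to |S| <= 4 n!, which is enough
   as n ln n >= 1 for n >= 2. *)

Require Import Defs.
From mathcomp Require Import zify ring lra.

Set Implicit Arguments.
Unset Strict Implicit.
Unset Printing Implicit Defensive.

Import Order.TTheory GRing.Theory Num.Theory.
Local Open Scope classical_set_scope.
Local Open Scope ring_scope.

Lemma dvd2_signed_sum (n : nat) (s : 'I_n -> bool) (d : 'I_n -> int) :
  (2 %| \sum_(i < n) d i)%Z -> (2 %| \sum_(i < n) (-1) ^+ s i * d i)%Z.
Proof.
move=> d_even; rewrite -(rpredDr _ d_even) -big_split /=.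
apply: rpred_sum => i _; case: (s i); rewrite ?mulN1r ?addNr ?rpred0 // mul1r.
by apply/dvdzP; exists (d i); ring.
Qed.

Lemma odd_manhattan_separation (R : realType) (n : nat) (x y : 'rV[R]_n)
    (d : 'I_n -> int) :
  odd_integer (manhattan x y) -> (2 %| \sum_(i < n) d i)%Z ->
  1 <= \sum_(i < n) `|x ord0 i - y ord0 i - (d i)%:~R|.
Proof.
move=> [k xy_odd] d_even.
pose s i := x ord0 i - y ord0 i < 0.
have /dvdzP[q sumsd] := dvd2_signed_sum s d_even.
apply: (@le_trans _ _ `|\sum_(i < n) (-1) ^+ s i *
    (x ord0 i - y ord0 i - (d i)%:~R)|); last first.
  apply: (le_trans (ler_norm_sum _ _ _)); apply: ler_sum => i _.
  by rewrite normrM normrX normrN1 expr1n mul1r.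
have -> : \sum_(i < n) (-1) ^+ s i * (x ord0 i - y ord0 i - (d i)%:~R) =
    (2 * k + 1 - q * 2)%:~R :> R.
  rewrite intrB -xy_odd -sumsd rmorph_sum /= -sumrB.
  apply: eq_bigr => i _; rewrite mulrBr -normrEsign.
  by rewrite intrM rmorphXn /= rmorphN1.
rewrite -intr_norm ler1z; lia.
Qed.

(** Both rounding errors lie in [0, 1) and enter the difference with opposite signs, so each
    coordinate moves by less than 1, not 2. *)
Lemma floor_separation (R : realType) (n N : nat) (x y : 'rV[R]_n)
    (d : 'I_n -> int) :
  odd_integer (manhattan x y) -> (2 %| \sum_(i < n) d i)%Z ->
  N%:Z - n%:Z <= \sum_(i < n)
    `|Num.floor (N%:R * x ord0 i) - Num.floor (N%:R * y ord0 i) - N%:Z * d i|.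
Proof.
move=> xy_odd d_even.
rewrite -(ler_int R) intrB rmorph_sum /=.
have := odd_manhattan_separation xy_odd d_even.
move/(ler_wpM2l (ler0n R N)); rewrite mulr1 mulr_sumr => le_N.
rewrite lerBlDr; apply: (le_trans le_N).
rewrite [n%:~R](_ : _ = \sum_(i < n) (1 : R)); last first.
  by rewrite sumr_const card_ord.
rewrite -big_split /=; apply: ler_sum => i _.
rewrite intr_norm !intrB intrM -{1}(normr_nat R N) -normrM.
have := floor_itv (N%:R * x ord0 i); have := floor_itv (N%:R * y ord0 i).
rewrite !intrD -!pmulrn.
set a := (Num.floor (_ * x _ _))%:~R; set b := (Num.floor _)%:~R.
move=> /andP[ylo yhi] /andP[xlo xhi].
rewrite -lerBlDl; apply: le_trans (lerB_dist _ _) _.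
by rewrite ler_norml; apply/andP; split; lra.
Qed.

(* The class of [v] modulo [K.+1] times the lattice of even-sum vectors. *)
Definition lattice_class (n K : nat) (v : 'I_n -> int) :
    {ffun 'I_n -> 'I_K.+1} * bool :=
  ([ffun i => inord `|(v i %% K.+1)%Z|%N],
   (2 %| \sum_(i < n) (v i %/ K.+1)%Z)%Z).

Lemma lattice_class_eq (n K : nat) (v w : 'I_n -> int) :
  lattice_class K v = lattice_class K w ->
  exists2 d : 'I_n -> int, (2 %| \sum_(i < n) d i)%Z &
    forall i, v i - w i = K.+1%:Z * d i.
Proof.
case=> /ffunP eq_mod eq_par.
exists (fun i => (v i %/ K.+1)%Z - (w i %/ K.+1)%Z).
  rewrite sumrB; move: eq_par.
  by move: (\sum_(i < n) _) (\sum_(i < n) _) => a b; lia.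
move=> i; have := eq_mod i; rewrite !ffunE => /(congr1 val) /=.
by rewrite !inordK; lia.
Qed.

(* Negative coordinates are [- (t_i + 1)], so that every pair (sign, t_i)
   gives a different integer. *)
Definition signed_point (n L : nat) (s : {ffun 'I_n -> bool})
    (t : n.-tuple 'I_L.+1) (i : 'I_n) : int :=
  if s i then Posz (tnth t i) else Negz (tnth t i).

Lemma signed_point_inj (n L : nat) (s s' : {ffun 'I_n -> bool})
    (t t' : n.-tuple 'I_L.+1) :
  signed_point s t =1 signed_point s' t' -> s = s' /\ t = t'.
Proof.
move=> eq_pt; split.
  by apply/ffunP=> i; have := eq_pt i; rewrite /signed_point; do 2?case: ifP.
apply: eq_from_tnth => i; apply: val_inj; have := eq_pt i.
by rewrite /signed_point; do 2?case: ifP => // _; case.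
Qed.

Lemma signed_point_norm (n L : nat) (s : {ffun 'I_n -> bool})
    (t : n.-tuple 'I_L.+1) :
  (\sum_(i <- t) i <= L)%N ->
  \sum_(i < n) `|signed_point s t i| <= (L + n)%N%:Z.
Proof.
rewrite big_tuple => sum_t.
apply: (@le_trans _ _ (\sum_(i < n) ((tnth t i : nat)%:Z + 1))).
  by apply: ler_sum => i _; rewrite /signed_point; case: ifP => _; lia.
rewrite big_split /= sumr_const card_ord natz PoszD.
by rewrite -(big_morph Posz PoszD (erefl _)) lerD2r lez_nat.
Qed.

(** Pigeonhole in place of volume: the translates by [X] of the discrete ball of signed points with
    tuple sum at most [L] have pairwise distinct classes under [lattice_class], whose codomain has 2
    (K + 1)^n elements. *)
Lemma packing_bound (n L K : nat) (I : finType) (X : I -> 'I_n -> int) :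
  (2 * (L + n) <= K)%N ->
  (forall a b (d : 'I_n -> int), a != b -> (2 %| \sum_(i < n) d i)%Z ->
     (2 * (L + n))%N%:Z < \sum_(i < n) `|X a i - X b i - K.+1%:Z * d i|) ->
  (#|I| * (2 ^ n * 'C(n + L, n)) <= 2 * K.+1 ^ n)%N.
Proof.
move=> le_K X_sep.
pose B := {t : n.-tuple 'I_L.+1 | (\sum_(i <- t) i <= L)%N}.
pose point (z : {ffun 'I_n -> bool} * B) := signed_point z.1 (val z.2).
pose f (z : I * ({ffun 'I_n -> bool} * B)) :=
  lattice_class K (fun i => X z.1 i + point z.2 i).
have f_inj : injective f.
  move=> [a p] [b q] /lattice_class_eq[d d_even] /= eq_d.
  have small : \sum_(i < n) `|point q i - point p i| <= (2 * (L + n))%N%:Z.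
    apply: (@le_trans _ _ (\sum_(i < n) (`|point q i| + `|point p i|))).
      by apply: ler_sum => i _; exact: ler_normB.
    rewrite big_split /= mul2n -addnn PoszD.
    by apply: lerD; apply: signed_point_norm; [exact: (valP q.2)|exact: (valP p.2)].
  have [eq_ab|neq_ab] := eqVneq a b; last first.
    have := X_sep a b d neq_ab d_even; rewrite ltNge => /negP[].
    apply: le_trans small; apply: ler_sum => i _.
    by rewrite -eq_d (_ : _ - _ = point q i - point p i) //; ring.
  (* Within one translate, coordinates differ by a multiple of [K.+1] of absolute value at most [K],
     that is, by 0. *)
  have eq_pt : point p =1 point q.
    move=> i; have : `|point q i - point p i| <= K%:Z.
      apply: le_trans (le_trans small _); last by rewrite lez_nat.
      by rewrite (bigD1 i) //= lerDl sumr_ge0.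
    have := eq_d i; rewrite eq_ab => eq_di.
    have -> : point q i - point p i = K.+1%:Z * - d i.
      by rewrite mulrN -eq_di; ring.
    have [d0 _|d_neq0] := eqVneq (d i) 0.
      by move: eq_di; rewrite d0; lia.
    by rewrite normrM; nia.
  case: p q eq_pt {small eq_d} => [s t] [s' t'] /signed_point_inj /=.
  case=> -> /val_inj ->.
  by rewrite eq_ab.
have := leq_card f f_inj.
rewrite !card_prod !card_ffun card_bool !card_ord card_sig.
rewrite (_ : #|_| = 'C(n + L, n)) 1?[(_ * 2)%N]mulnC //.
by rewrite -card_partial_ord_partitions cardsE.
Qed.

(** Every factor on the right is at least L + 1. Hence 2^n C(n + L, n) >= (2 (L + 1))^n / n!, the
    volume of a cross-polytope of radius L + 1. *)
Lemma ffact_lower_bound (n L : nat) : (L.+1 ^ n <= (n + L) ^_ n)%N.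
Proof.
elim: n => [|n IHn] //; rewrite addSn ffactSS expnS.
by apply: leq_mul => //; rewrite ltnS leq_addl.
Qed.

(* Bernoulli's inequality [(1 - c / (A + c)) ^ k >= 1 - k c / (A + c)], cleared
   of denominators. *)
Lemma bernoulli_nat (A c k : nat) :
  ((A + c) ^ k * (A + c - k * c) <= A ^ k * (A + c))%N.
Proof.
elim: k => [|k IHk]; first by rewrite mul0n subn0.
have step : ((A + c) * (A + c - k.+1 * c) <= A * (A + c - k * c))%N.
  have [le_c|/ltnW lt_c] := leqP (k.+1 * c) (A + c); last first.
    by move: lt_c; rewrite -subn_eq0 => /eqP->; rewrite muln0.
  by rewrite mulSn in le_c *; nia.
rewrite !expnS -!mulnA mulnCA.
apply: leq_trans (_ : (A + c) ^ k * (A * (A + c - k * c)) <= _)%N.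
  by rewrite leq_mul2l step orbT.
by rewrite mulnCA leq_mul2l IHk orbT.
Qed.

Lemma odd_distance_fset_card (R : realType) (n : nat) (F : {fset 'rV[R]_n}) :
  odd_distance_set [set` F] -> (#|` F| <= 4 * n`!)%N.
Proof.
move=> F_odd; pose L := (3 * n ^ 2)%N; pose K := (2 * L + 3 * n)%N.
(* [K.+1] is the least [N] with [2 (L + n) < N - n]; [L] is large enough that
   [N ^ n <= 2 (2 L + 2) ^ n]. *)
have le_K : (2 * (L + n) <= K)%N by rewrite /K; lia.
pose X (a : F) i := Num.floor (K.+1%:R * val a ord0 i).
have le_F : (#|` F| * (2 ^ n * 'C(n + L, n)) <= 2 * K.+1 ^ n)%N.
  rewrite cardfE; apply: (packing_bound (X := X)) => //.
  move=> a b d neq_ab d_even.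
  have ab_odd : odd_integer (manhattan (val a) (val b)).
    apply: F_odd; [exact: valP|exact: valP|].
    by move=> /val_inj/eqP; apply/negP.
  by apply: lt_le_trans (floor_separation K.+1 ab_odd d_even); rewrite /K; lia.
pose A := (2 * L.+1)%N.
have A_gt0 : (0 < A ^ n)%N by rewrite expn_gt0.
rewrite -(leq_pmul2r A_gt0).
have le1 : (#|` F| * A ^ n <= n`! * (2 * K.+1 ^ n))%N.
  apply: leq_trans (_ : n`! * (#|` F| * (2 ^ n * 'C(n + L, n))) <= _)%N.
    rewrite mulnCA leq_mul2l; apply/orP; right.
    rewrite mulnCA [(n`! * _)%N]mulnC bin_ffact expnMn leq_mul2l.
    by rewrite ffact_lower_bound orbT.
  by rewrite leq_mul2l le_F orbT.
apply: leq_trans le1 _.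
rewrite [X in (_ <= X)%N](_ : _ = n`! * (2 * (2 * A ^ n)))%N; last by ring.
rewrite !leq_mul2l /=; apply/orP; right.
(* The next identity fails for n = 0, where [K.+1] is 1 and [A] is 2. *)
have [->|n_gt0] := posnP n; first by [].
have eq_K : K.+1 = (A + (3 * n).-1)%N by rewrite /K /A; lia.
have := bernoulli_nat A (3 * n).-1 n; rewrite -eq_K => bern.
(* The Bernoulli factor is at least 1/2, because 2 n (3 n - 1) <= 6 n^2 = 2 L <= K + 1. *)
have half : (K.+1 <= 2 * (K.+1 - n * (3 * n).-1))%N.
  rewrite /K /L; nia.
rewrite -(leq_pmul2r (ltn0Sn K)).
apply: leq_trans (_ : K.+1 ^ n * (2 * (K.+1 - n * (3 * n).-1)) <= _)%N.
  by rewrite leq_mul2l half orbT.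
by rewrite mulnCA -mulnA leq_mul2l bern orbT.
Qed.

Theorem theorem6 (R : realType) (eps : R) (heps : 0 < eps) :
  exists n0 : nat, forall n : nat, (n0 <= n)%N ->
    forall S : set 'rV[R]_n, odd_distance_set S ->
      finite_set S /\
      (#|` fset_set S|)%:R <= (4 + eps) * (n`!)%:R * n%:R * ln (n%:R : R).
Proof.
exists 2%N => n n_ge2 S S_odd.
have S_fin : finite_set S.
  (* An infinite set would contain a finite subset exceeding the uniform bound 4 n!. *)
  apply: contrapT => S_inf.
  have [F F_S] := infinite_set_fset (4 * n`!).+1 S_inf.
  rewrite ltnNge odd_distance_fset_card // => x y Fx Fy.
  by apply: S_odd; exact: F_S.
split=> //.
have n_gt0 : 0 < n%:R :> R by rewrite ltr0n; lia.
have nln_ge1 : 1 <= n%:R * ln (n%:R : R).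
  have inv_gt0 : 0 < (n%:R : R)^-1 by rewrite invr_gt0.
  (* ln (1 + x) <= x at x = 1/n - 1 gives ln n >= 1 - 1/n, so n ln n >= n - 1 >= 1. *)
  have := @le_ln1Dx R (n%:R^-1 - 1); rewrite ltrBrDl addrN.
  rewrite addrC subrK lnV ?posrE // => /(_ inv_gt0).
  rewrite lerNl opprB => le_ln.
  apply: le_trans (_ : n%:R * (1 - n%:R^-1) <= _); last by rewrite ler_pM2l.
  rewrite mulrBr mulr1 divff ?gt_eqF // lerBrDr.
  by rewrite -[leLHS]/(2%:R) ler_nat.
have card_le : (#|` fset_set S|)%:R <= 4 * (n`!)%:R :> R.
  rewrite -natrM ler_nat odd_distance_fset_card //.
  by rewrite fset_setK.
apply: le_trans card_le _; rewrite -mulrA.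
apply: le_trans (_ : (4 + eps) * (n`!)%:R <= _).
  by rewrite ler_wpM2r // lerDl ltW.
by rewrite ler_peMr // mulr_ge0 // addr_ge0 // ltW.
Qed.
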